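(* Let $\mathcal{G}$ be the category of finite graphs and graph maps. There does not exist a model structure on $\mathcal{G}$ such that the weak equivalences are exactly the $\times$-homotopy equivalences and the class of cofibrations is a subclass (any subclass) of the class of induced subgraph inclusions.
   Context: A graph $G$ is a pair $(V(G),E(G))$ where $E(G)$ is a set of unordered pairs $\{x,y\}$ (written $xy$) of vertices, with $x=y$ allowed (a loop); there are no multiple edges. All graphs are finite. A graph map $f:G\to H$ is a function $V(G)\to V(H)$ such that $xy\in E(G)$ implies $f(x)f(y)\in E(H)$. $\mathcal{G}$ is the category of finite graphs and graph maps. The product $G\times H$ has vertex set $V(G)\times V(H)$, and $(g,h)(g',h')\in E(G\times H)$ iff $gg'\in E(G)$ and $hh'\in E(H)$. For $n\in\mathbb{N}$, $I_n$ is the graph with vertex set $\{0,1,\dots,n\}$ and edges $ij$ for $|i-j|\le 1$ (so every vertex is looped). Two graph maps $f,g:A\to B$ are $\times$-homotopic, $f\simeq_\times g$, if for some $n\in\mathbb{N}$ there is a graph map $F:A\times I_n\to B$ with $F(a,0)=f(a)$ and $F(a,n)=g(a)$ for all $a\in V(A)$. A graph map $f:A\to B$ is a $\times$-homotopy equivalence if there is a graph map $g:B\to A$ with $gf\simeq_\times 1_A$ and $fg\simeq_\times 1_B$. An induced subgraph inclusion is (up to isomorphism) the inclusion of an induced subgraph, i.e. an injective graph map $i:A\to B$ such that $i(a)i(b)\in E(B)$ implies $ab\in E(A)$ for all $a,b\in V(A)$ (including $a=b$). A model structure on a category is a choice of three classes of morphisms (cofibrations, fibrations, weak equivalences) such that: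 (1) all finite limits and finite colimits exist; (2) each of the three classes is closed under retracts (of morphisms); (3) if $gf$ is defined and two of $f,g,gf$ are weak equivalences, so is the third; (4) acyclic cofibrations (cofibrations that are weak equivalences) have the left lifting property with respect to fibrations, and cofibrations have the left lifting property with respect to acyclic fibrations (fibrations that are weak equivalences); (5) every morphism factors as a cofibration followed by an acyclic fibration, and as an acyclic cofibration followed by a fibration. *)

(* Defs.v *)
From mathcomp Require Import all_boot.

Set Implicit Arguments.
Unset Strict Implicit.
Unset Printing Implicit Defensive.

(* Composition is written in applicative order: [comp g f] is g after f. *)
Record category := Category {
  obj :> Type;
  hom : obj -> obj -> Type;
  idm : forall a, hom a a;
  comp : forall a b c, hom b c -> hom a b -> hom a c;
  comp_idl : forall a b (f : hom a b), comp (idm b) f = f;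
  comp_idr : forall a b (f : hom a b), comp f (idm a) = f;
  comp_assoc : forall a b c d (h : hom c d) (g : hom b c) (f : hom a b),
    comp h (comp g f) = comp (comp h g) f
}.
Arguments hom {_} a b.
Arguments idm {_} a.
Arguments comp {_ _ _ _} g f.

Declare Scope cat_scope.
Delimit Scope cat_scope with cat.
Notation "g ∘ f" := (comp g f) (at level 40, left associativity) : cat_scope.
Local Open Scope cat_scope.

Record functor (J C : category) := Functor {
  fobj :> J -> C;
  fmap : forall i j : J, hom i j -> hom (fobj i) (fobj j);
  fmap_id : forall i : J, fmap (idm i) = idm (fobj i);
  fmap_comp : forall (i j k : J) (v : hom j k) (u : hom i j),
    fmap (v ∘ u) = fmap v ∘ fmap u
}.
Arguments fmap {_ _} _ {_ _} _.

Definition finite_type (T : Type) : Prop :=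
  exists (n : nat) (e : 'I_n -> T), forall x, exists i, e i = x.

Definition finite_category (J : category) : Prop :=
  finite_type J /\ forall i j : J, finite_type (hom i j).

Section Limits.
Variables (J C : category) (F : functor J C).

Definition is_cone (L : C) (p : forall j, hom L (F j)) : Prop :=
  forall (i j : J) (u : hom i j), fmap F u ∘ p i = p j.

Definition is_limit (L : C) (p : forall j, hom L (F j)) : Prop :=
  is_cone p /\
  forall (X : C) (q : forall j, hom X (F j)), is_cone q ->
    exists! h : hom X L, forall j, p j ∘ h = q j.

Definition is_cocone (L : C) (p : forall j, hom (F j) L) : Prop :=
  forall (i j : J) (u : hom i j), p j ∘ fmap F u = p i.

Definition is_colimit (L : C) (p : forall j, hom (F j) L) : Prop :=
  is_cocone p /\
  forall (X : C) (q : forall j, hom (F j) X), is_cocone q ->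
    exists! h : hom L X, forall j, h ∘ p j = q j.

End Limits.

Definition has_finite_limits (C : category) : Prop :=
  forall (J : category) (F : functor J C), finite_category J ->
    exists (L : C) (p : forall j, hom L (F j)), is_limit p.

Definition has_finite_colimits (C : category) : Prop :=
  forall (J : category) (F : functor J C), finite_category J ->
    exists (L : C) (p : forall j, hom (F j) L), is_colimit p.

Definition mor_class (C : category) := forall a b : C, hom a b -> Prop.

Section MorphismClasses.
Variable C : category.

Definition retract_of (a b c d : C) (f : hom a b) (g : hom c d) : Prop :=
  exists (i : hom a c) (r : hom c a) (j : hom b d) (s : hom d b),
    [/\ r ∘ i = idm a, s ∘ j = idm b, g ∘ i = j ∘ f & f ∘ r = s ∘ g].

Definition retract_closed (P : mor_class C) : Prop :=
  forall (a b c d : C) (f : hom a b) (g : hom c d),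
    retract_of f g -> P c d g -> P a b f.

Definition two_of_three (P : mor_class C) : Prop :=
  forall (a b c : C) (f : hom a b) (g : hom b c),
    [/\ P a b f -> P b c g -> P a c (g ∘ f),
        P a b f -> P a c (g ∘ f) -> P b c g
      & P b c g -> P a c (g ∘ f) -> P a b f].

Definition has_llp (a b c d : C) (i : hom a b) (p : hom c d) : Prop :=
  forall (u : hom a c) (v : hom b d), p ∘ u = v ∘ i ->
    exists h : hom b c, h ∘ i = u /\ p ∘ h = v.

Definition class_llp (P Q : mor_class C) : Prop :=
  forall (a b c d : C) (i : hom a b) (p : hom c d),
    P a b i -> Q c d p -> has_llp i p.

Definition factors_as (P Q : mor_class C) : Prop :=
  forall (a b : C) (f : hom a b),
    exists (c : C) (i : hom a c) (p : hom c b),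
      [/\ P a c i, Q c b p & p ∘ i = f].

Definition class_meet (P Q : mor_class C) : mor_class C :=
  fun a b f => P a b f /\ Q a b f.

End MorphismClasses.

Record model_structure (C : category) := ModelStructure {
  cof : mor_class C;
  fib : mor_class C;
  weq : mor_class C;
  ms_lim : has_finite_limits C;
  ms_colim : has_finite_colimits C;
  cof_retract : retract_closed cof;
  fib_retract : retract_closed fib;
  weq_retract : retract_closed weq;
  weq_two_of_three : two_of_three weq;
  acof_llp_fib : class_llp (class_meet cof weq) fib;
  cof_llp_afib : class_llp cof (class_meet fib weq);
  factor_cof_afib : factors_as cof (class_meet fib weq);
  factor_acof_fib : factors_as (class_meet cof weq) fib
}.
Arguments cof {_} _ {_ _} _.
Arguments fib {_} _ {_ _} _.
Arguments weq {_} _ {_ _} _.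

(* [edge x x] is allowed: it says that x carries a loop. *)
Record graph := Graph {
  vertex :> finType;
  edge : rel vertex;
  edge_sym : symmetric edge
}.
Arguments edge {_} x y : rename.

Definition is_graph_map (G H : graph) (f : G -> H) : bool :=
  [forall x, forall y, edge x y ==> edge (f x) (f y)].

(* Finite functions and a boolean condition make Leibniz equality of graph
   maps coincide with equality of the vertex functions. *)
Record graph_map (G H : graph) := GraphMap {
  gm_fun :> {ffun G -> H};
  gm_map : is_graph_map gm_fun
}.

Lemma graph_mapP (G H : graph) (f : G -> H) :
  reflect (forall x y, edge x y -> edge (f x) (f y)) (is_graph_map f).
Proof.
apply: (iffP forallP) => [h x y | h x]; first by move/forallP: (h x) => /(_ y)/implyP.
by apply/forallP => y; apply/implyP; apply: h.
Qed.

Lemma graph_map_eq (G H : graph) (f g : graph_map G H) : f =1 g -> f = g.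
Proof.
case: f g => [f hf] [g hg] /= /ffunP efg; case: g / efg hg => hg.
by rewrite (bool_irrelevance hf hg).
Qed.

Fact graph_id_subproof (G : graph) : @is_graph_map G G [ffun x => x].
Proof. by apply/graph_mapP => x y; rewrite !ffunE. Qed.

Definition graph_id (G : graph) : graph_map G G :=
  GraphMap (graph_id_subproof G).

Fact graph_comp_subproof (G H K : graph) (g : graph_map H K)
  (f : graph_map G H) : @is_graph_map G K [ffun x => g (f x)].
Proof.
apply/graph_mapP => x y exy; rewrite !ffunE.
by apply: (graph_mapP _ (gm_map g)); apply: (graph_mapP _ (gm_map f)).
Qed.

Definition graph_comp (G H K : graph) (g : graph_map H K)
  (f : graph_map G H) : graph_map G K :=
  GraphMap (graph_comp_subproof g f).

Fact graph_comp_idl (G H : graph) (f : graph_map G H) :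
  graph_comp (graph_id H) f = f.
Proof. by apply: graph_map_eq => x; rewrite !ffunE. Qed.

Fact graph_comp_idr (G H : graph) (f : graph_map G H) :
  graph_comp f (graph_id G) = f.
Proof. by apply: graph_map_eq => x; rewrite !ffunE. Qed.

Fact graph_comp_assoc (G H K L : graph) (h : graph_map K L)
  (g : graph_map H K) (f : graph_map G H) :
  graph_comp h (graph_comp g f) = graph_comp (graph_comp h g) f.
Proof. by apply: graph_map_eq => x; rewrite !ffunE. Qed.

Definition graph_category : category :=
  Category graph_comp_idl graph_comp_idr graph_comp_assoc.

Definition prod_edge (G H : graph) : rel (G * H) :=
  fun p q => edge p.1 q.1 && edge p.2 q.2.

Fact prod_edge_sym (G H : graph) : symmetric (@prod_edge G H).
Proof. by move=> p q; rewrite /prod_edge edge_sym [edge p.2 _]edge_sym. Qed.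

Definition graph_prod (G H : graph) : graph := Graph (@prod_edge_sym G H).

(* |i - j| <= 1, avoiding truncated subtraction *)
Definition path_edge (n : nat) : rel 'I_n.+1 :=
  fun i j => (i <= j.+1) && (j <= i.+1).

Fact path_edge_sym (n : nat) : symmetric (@path_edge n).
Proof. by move=> i j; rewrite /path_edge andbC. Qed.

Definition looped_path (n : nat) : graph := Graph (@path_edge_sym n).

Definition x_homotopic (A B : graph) (f g : graph_map A B) : Prop :=
  exists (n : nat) (F : graph_map (graph_prod A (looped_path n)) B),
    (forall a : A, F (a, ord0) = f a) /\ (forall a : A, F (a, ord_max) = g a).

Definition x_homotopy_equivalence (A B : graph) (f : graph_map A B) : Prop :=
  exists g : graph_map B A,
    x_homotopic (graph_comp g f) (graph_id A) /\
    x_homotopic (graph_comp f g) (graph_id B).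

Definition induced_inclusion (A B : graph) (i : graph_map A B) : Prop :=
  injective i /\ forall a b : A, edge (i a) (i b) -> edge a b.

(* Main.v *)
(** Write 1 for the looped vertex.  The vertex 1 is cofibrant, being a retract
    of a cofibrant replacement of itself, so factoring the fold map 1 + 1 -> 1
    as a cofibration followed by an acyclic fibration yields an acyclic
    cofibration 1 -> K whose target has a second looped vertex, since
    cofibrations are injective.  Now factor a vertex 1 -> C of the reflexive
    7-cycle as an acyclic cofibration 1 -> E followed by a fibration E -> C.
    As E is contractible, E -> C lifts to an integer-valued function on E that
    varies by at most one along edges.  Lifting 1 -> K against E -> C from a
    looped vertex of E of maximal height produces a looped vertex that is one
    step higher, which is impossible because E is finite. *)
From mathcomp Require Import all_boot order ssralg ssrnum ssrint zify.
Require Import Defs.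

Set Implicit Arguments.
Unset Strict Implicit.
Unset Printing Implicit Defensive.

Import Order.TTheory GRing.Theory Num.Theory.

(** The retract argument: lifting [f] against the second half of its own factorization exhibits [f]
    as a retract of the first half. *)
Lemma cof_of_llp_afib (C : category) (M : model_structure C) (a b : C)
    (f : hom a b) :
  (forall (c d : C) (p : hom c d), fib M p -> weq M p -> has_llp f p) ->
  cof M f.
Proof.
move=> llp_f; have [c [i [p [cof_i [fib_p weq_p] def_f]]]] := factor_cof_afib M f.
have sq : comp p i = comp (idm b) f by rewrite comp_idl.
have [h [hf ph]] := llp_f _ _ _ fib_p weq_p _ _ sq.
apply: (cof_retract (m := M) (g := i)) => //.
by exists (idm a), (idm a), h, p; rewrite !comp_idr.
Qed.

(** * Graph maps and homotopies *)

Section GraphMaps.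
Variables G H : graph.

Lemma graph_map_edge (f : graph_map G H) (x y : G) :
  edge x y -> edge (f x) (f y).
Proof. by move: x y; apply/graph_mapP/gm_map. Qed.

Fact mk_graph_map_subproof (f : G -> H) :
  (forall x y, edge x y -> edge (f x) (f y)) -> is_graph_map [ffun x => f x].
Proof. by move=> fE; apply/graph_mapP => x y /fE; rewrite !ffunE. Qed.

Definition mk_graph_map (f : G -> H)
    (fE : forall x y, edge x y -> edge (f x) (f y)) : graph_map G H :=
  GraphMap (mk_graph_map_subproof fE).

Lemma mk_graph_mapE (f : G -> H) fE x : @mk_graph_map f fE x = f x.
Proof. exact: ffunE. Qed.

Definition const_map (y : H) (yy : edge y y) : graph_map G H :=
  @mk_graph_map (fun=> y) (fun _ _ _ => yy).

End GraphMaps.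

Lemma graph_compE (G H K : graph) (g : graph_map H K) (f : graph_map G H) x :
  graph_comp g f x = g (f x).
Proof. exact: ffunE. Qed.

Lemma graph_comp_apply (G H K : graph) (g : graph_map H K) (f : graph_map G H)
    (k : graph_map G K) : graph_comp g f = k -> forall x, g (f x) = k x.
Proof. by move=> <- x; rewrite graph_compE. Qed.

Lemma graph_comp_eqP (G H K L : graph) (g : graph_map H L) (f : graph_map G H)
    (g' : graph_map K L) (f' : graph_map G K) :
  graph_comp g f = graph_comp g' f' <-> forall x, g (f x) = g' (f' x).
Proof.
split=> [e x | e]; first by rewrite -!graph_compE e.
by apply: graph_map_eq => x; rewrite !graph_compE.
Qed.

Lemma x_homotopic_refl (A B : graph) (f : graph_map A B) : x_homotopic f f.
Proof.
have fE (x y : graph_prod A (looped_path 0)) : edge x y -> edge (f x.1) (f y.1).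
  by case/andP => xy _; apply: graph_map_edge.
by exists 0, (mk_graph_map fE); split=> a; rewrite mk_graph_mapE.
Qed.

Lemma x_homotopy_equivalence_id (A : graph) :
  x_homotopy_equivalence (graph_id A).
Proof.
exists (graph_id A); rewrite graph_comp_idl.
by split; apply: x_homotopic_refl.
Qed.

(** * The empty graph, the point and two points *)

Fact empty_edge_sym : symmetric (fun _ _ : void => true). Proof. by []. Qed.
Definition empty_graph : graph := Graph empty_edge_sym.

Fact point_edge_sym : symmetric (fun _ _ : unit => true). Proof. by []. Qed.
Definition point_graph : graph := Graph point_edge_sym.

Fact two_points_edge_sym : symmetric (@eq_op bool).
Proof. exact: eq_sym. Qed.
(** The coproduct 1 + 1: the only edges are the two loops. *)
Definition two_points_graph : graph := Graph two_points_edge_sym.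

Definition from_empty (G : graph) : graph_map empty_graph G :=
  @mk_graph_map empty_graph G (fun x => match x with end)
    (fun x => match x with end).

Lemma to_point_eq (G : graph) (f g : graph_map G point_graph) : f = g.
Proof. by apply: graph_map_eq => x; case: (f x); case: (g x). Qed.

Lemma from_empty_eq (G : graph) (f g : graph_map empty_graph G) : f = g.
Proof. by apply: graph_map_eq; case. Qed.

Definition to_point (G : graph) : graph_map G point_graph :=
  const_map G (y := tt : point_graph) isT.

Definition point_map (G : graph) (x : G) (xx : edge x x) :
  graph_map point_graph G := const_map point_graph xx.

(** * Contractible graphs *)

Definition contractible (G : graph) : Prop :=
  exists (c : G) (n : nat) (F : graph_map (graph_prod G (looped_path n)) G),
    (forall a, F (a, ord0) = c) /\ (forall a, F (a, ord_max) = a).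

Lemma contractible_to_point (G : graph) (f : graph_map G point_graph) :
  x_homotopy_equivalence f -> contractible G.
Proof.
move=> [g [[n [F [F0 F1]]] _]]; exists (g tt), n, F; split=> a.
  by rewrite F0 graph_compE; case: (f a).
by rewrite F1 ffunE.
Qed.

Lemma contractible_of_point (G : graph) (f : graph_map point_graph G) :
  x_homotopy_equivalence f -> contractible G.
Proof.
move=> [g [_ [n [F [F0 F1]]]]]; exists (f tt), n, F; split=> a.
  by rewrite F0 graph_compE; case: (g a).
by rewrite F1 ffunE.
Qed.

Lemma homotopy_step (A B : graph) (n : nat)
    (F : graph_map (graph_prod A (looped_path n)) B) (a b : A) (k l : nat) :
  edge a b -> k <= l.+1 -> l <= k.+1 -> k <= n -> l <= n ->
  edge (F (a, inord k)) (F (b, inord l)).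
Proof.
move=> ab kl lk kn ln; apply: graph_map_edge.
by rewrite /= /prod_edge /= ab /= /path_edge !inordK ?ltnS // kl lk.
Qed.

(** The contraction moves a looped vertex along a walk joining it to [c]. Without the loop,
    successive positions need not be adjacent. *)
Lemma contractible_const (G : graph) (T : Type) (f : G -> T) :
  contractible G -> (forall x y, edge x y -> f x = f y) ->
  forall x y : G, edge x x -> edge y y -> f x = f y.
Proof.
move=> [c [n [F [F0 F1]]]] fE.
suff fc x : edge x x -> f x = f c by move=> x y xx yy; rewrite !fc.
move=> xx; suff fF k : k <= n -> f (F (x, inord k)) = f c.
  by rewrite -(fF n (leqnn n)) -[in LHS](F1 x); congr (f (F (_, _)));
    apply: val_inj; rewrite /= inordK.
elim: k => [_ | k IHk kn].
  by rewrite -(F0 x); congr (f (F (_, _))); apply: val_inj; rewrite /= inordK.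
by rewrite -IHk 1?ltnW //; apply: fE; apply: homotopy_step; rewrite // ltnW.
Qed.

(** * The reflexive 7-cycle and its covering by the integers *)

Definition cycle7_edge : rel 'I_7 :=
  fun x y => [|| x == y, y == x.+1 %% 7 :> nat | x == y.+1 %% 7 :> nat].

Fact cycle7_edge_sym : symmetric cycle7_edge.
Proof. by move=> x y; rewrite /cycle7_edge eq_sym [X in _ || X]orbC. Qed.

Definition cycle7 : graph := Graph cycle7_edge_sym.

Lemma cycle7_loop (x : cycle7) : edge x x.
Proof. by rewrite /= /cycle7_edge eqxx. Qed.

Definition cycle7_succ (x : cycle7) : cycle7 := inord (x.+1 %% 7).

Lemma cycle7_succE (x : cycle7) : cycle7_succ x = x.+1 %% 7 :> nat.
Proof. by rewrite inordK ?ltn_mod. Qed.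

Lemma cycle7_edge_succ (x : cycle7) : edge x (cycle7_succ x).
Proof. by rewrite /= /cycle7_edge cycle7_succE eqxx orbT. Qed.

Local Open Scope ring_scope.

(** The fibres of the covering of the reflexive 7-cycle by the reflexive integer line. *)
Definition lies_over (z : int) (x : cycle7) : Prop :=
  exists k : int, z = (x : nat)%:Z + 7 * k.

Lemma cycle7_edge_diff (x y : cycle7) : edge x y ->
  exists k : int, `|(y : nat)%:Z + 7 * k - (x : nat)%:Z| <= 1.
Proof.
rewrite /= /cycle7_edge -val_eqE /= => xy.
have x7 := ltn_ord x; have y7 := ltn_ord y.
(* Adjacent residues at least 2 apart are 0 and 6, where the edge wraps around. *)
have [yx | yx] := leqP y.+2 x; first by exists 1; lia.
have [xy' | xy'] := leqP x.+2 y; first by exists (- 1); lia.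
by exists 0; lia.
Qed.

Lemma lies_over_edge (z : int) (x y : cycle7) :
  lies_over z x -> edge x y ->
  exists2 w, lies_over w y & `|w - z| <= 1.
Proof.
move=> [k ->] /cycle7_edge_diff [l dl].
exists ((y : nat)%:Z + 7 * (k + l)); first by exists (k + l).
lia.
Qed.

(* 5 = 2 + 1 + 2 is the drift of an edge difference when both ends move by at
   most 2, and a difference congruent to -1, 0 or 1 modulo 7 that exceeds 1 is
   at least 6: this fixes the length of the cycle. *)
Lemma lies_over_edge_close (z w : int) (x y : cycle7) :
  lies_over z x -> lies_over w y -> edge x y -> `|w - z| <= 5 ->
  `|w - z| <= 1.
Proof. by move=> [k ->] [l ->] /cycle7_edge_diff [m dm]; lia. Qed.

(** The constant start lifts to a constant, and heights are then extended one time step at a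
    time. *)
Lemma homotopy_lift (A : graph) (n : nat)
    (F : graph_map (graph_prod A (looped_path n)) cycle7) (c : cycle7) :
  (forall a, F (a, ord0) = c) ->
  exists phi : A -> int,
    (forall a, lies_over (phi a) (F (a, ord_max))) /\
    (forall a b, edge a b -> `|phi a - phi b| <= 1).
Proof.
move=> F0; suff lift k : (k <= n)%N -> exists phi : A -> int,
    (forall a, lies_over (phi a) (F (a, inord k))) /\
    (forall a b, edge a b -> `|phi a - phi b| <= 1).
  have [phi [phiF phiE]] := lift n (leqnn n); exists phi; split=> // a.
  suff <- : inord n = ord_max :> 'I_n.+1 by apply: phiF.
  by apply: val_inj; rewrite /= inordK.
elim: k => [_ | k IHk kn].
  exists (fun=> (c : nat)%:Z); split=> [a | a b _]; last by rewrite subrr.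
  suff -> : inord 0 = ord0 :> 'I_n.+1 by rewrite F0; exists 0; rewrite mulr0 addr0.
  by apply: val_inj; rewrite /= inordK.
have [phi [phiF phiE]] := IHk (ltnW kn).
(* If [a] has no loop, its images at times [k] and [k.+1] need not be adjacent. The new height is
   reached through a neighbour [b], at distance 1 + 1. An isolated vertex may take any height. *)
have step a : exists w : int, lies_over w (F (a, inord k.+1)) /\
    forall b, edge a b -> `|w - phi a| <= 2.
  case: (pickP (fun b : A => edge a b)) => [b ab | noE].
    have ba : edge b a by rewrite edge_sym.
    have eF : edge (F (b, inord k)) (F (a, inord k.+1)).
      by apply: homotopy_step; rewrite // ltnW.
    have [w wF wb] := lies_over_edge (phiF b) eF.
    by exists w; split=> // _ _; have := phiE _ _ ab; lia.
  exists (F (a, inord k.+1) : nat)%:Z; split=> [|b]; last by rewrite noE.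
  by exists 0; rewrite mulr0 addr0.
have [psi psiP] := fin_all_exists step; exists psi.
split=> [a | a b ab]; first by case: (psiP a).
have [psia /(_ _ ab) da] := psiP a; have ba : edge b a by rewrite edge_sym.
have [psib /(_ _ ba) db] := psiP b; have := phiE _ _ ab => dab.
apply: (lies_over_edge_close psib psia); last lia.
by apply: homotopy_step; rewrite // ltnW.
Qed.

(** Composed with [p], the contraction is a homotopy from a constant map to [p]. *)
Lemma contractible_lift (A : graph) (p : graph_map A cycle7) :
  contractible A ->
  exists phi : A -> int,
    (forall a, lies_over (phi a) (p a)) /\
    (forall a b, edge a b -> `|phi a - phi b| <= 1).
Proof.
move=> [c [n [F [F0 F1]]]].
have [|phi [phiF phiE]] := @homotopy_lift A n (graph_comp p F) (p c).
  by move=> a; rewrite graph_compE F0.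
by exists phi; split=> // a; have := phiF a; rewrite graph_compE F1.
Qed.

Lemma contractible_not_llp_cycle7 (K E : graph) (k0 k1 : K) (k00 : edge k0 k0)
    (p : graph_map E cycle7) (e0 : E) :
  contractible K -> edge k1 k1 -> k0 != k1 ->
  contractible E -> edge e0 e0 ->
  ~ @has_llp graph_category _ _ _ _ (point_map k00) p.
Proof.
move=> ctrK k11 k01 ctrE e00 llp.
have [phi [phip phiE]] := contractible_lift p ctrE.
pose loop (e : E) := edge e e.
have [e ee emax] := @arg_maxP _ _ _ e0 loop phi e00.
(* Both values are looped and adjacent, so this is a graph map whatever the edges of [K]. *)
pose v0 (k : K) := if k == k0 then p e else cycle7_succ (p e).
have v0E x y : edge x y -> edge (v0 x) (v0 y).
  rewrite /v0 => _; do 2!case: ifP => _; rewrite ?cycle7_loop //;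
    by rewrite ?cycle7_edge_succ // edge_sym cycle7_edge_succ.
have [|h [h0 hv]] := llp (point_map ee) (mk_graph_map v0E).
  by apply/graph_comp_eqP => x; rewrite !mk_graph_mapE /v0 eqxx.
have {}h0 : gm_fun h k0 = e.
  by have := graph_comp_apply h0 tt; rewrite !mk_graph_mapE.
have {}hv k : p (gm_fun h k) = v0 k.
  by rewrite (graph_comp_apply hv) mk_graph_mapE.
(* the height along h, corrected so as to be locally constant *)
pose psi k := phi (gm_fun h k) - (k != k0)%:Z.
(* All values of [psi] are congruent to [p e] modulo 7, and an edge changes [psi] by at most 2. *)
have psiE x y : edge x y -> psi x = psi y.
  move=> xy; have := phiE _ _ (graph_map_edge h xy).
  have [a] := phip (gm_fun h x); have [b] := phip (gm_fun h y).
  rewrite /psi !hv /v0; have := cycle7_succE (p e); have := ltn_ord (p e).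
  by case: (x == k0); case: (y == k0) => /=; lia.
have := contractible_const ctrK psiE k00 k11.
rewrite /psi h0 eqxx eq_sym k01 /= => heq.
have := emax (gm_fun h k1) (graph_map_edge h k11); lia.
Qed.

Theorem theorem4p5 :
  ~ exists M : model_structure graph_category,
      (forall (A B : graph) (f : graph_map A B),
          @weq graph_category M A B f <-> x_homotopy_equivalence f) /\
      (forall (A B : graph) (f : graph_map A B),
          @cof graph_category M A B f -> induced_inclusion f).
Proof.
move=> [M [weqP cofP]].
(* The homotopy inverse [g] of [q] is a section of [q], since the point has only one self-map. *)
have cof_point : @cof graph_category M _ _ (from_empty point_graph).
  have [Q [i [q [cof_i [_ /weqP[g _]] _]]]] :=
    factor_cof_afib M (from_empty point_graph : @hom graph_category _ _).
  apply: (cof_retract (m := M) (g := i)) => //.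
  exists (graph_id _), (graph_id _), g, q.
  by split; [exact: from_empty_eq | exact: to_point_eq
    | exact: from_empty_eq | exact: from_empty_eq].
have [K [i [q [cof_i [_ weq_q] _]]]] :=
  factor_cof_afib M (to_point two_points_graph : @hom graph_category _ _).
pose k0 : K := i true; pose k1 : K := i false.
have k00 : edge k0 k0 by apply: graph_map_edge.
have k11 : edge k1 k1 by apply: graph_map_edge.
have k01 : k0 != k1 by apply/eqP => /(proj1 (cofP _ _ _ cof_i)).
have weq_k : @weq graph_category M _ _ (point_map k00).
  have [_ _ W] := weq_two_of_three M (point_map k00 : @hom graph_category _ _) q.
  apply: W => //.
  suff -> : comp q (point_map k00 : @hom graph_category _ _) = graph_id point_graph.
    exact/weqP/x_homotopy_equivalence_id.
  exact: to_point_eq.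
(* The lift is built in two stages: [w] lifts the other point by cofibrancy of 1, then [u] and [w]
   together form a map on 1 + 1, which extends along [i]. *)
have cof_k : @cof graph_category M _ _ (point_map k00).
  apply: cof_of_llp_afib => c d p fib_p weq_p u v sq.
  have sq0 : graph_comp p (from_empty c) =
      graph_comp (graph_comp v (graph_comp i (point_map (x := false : two_points_graph) isT)))
                 (from_empty point_graph).
    exact: from_empty_eq.
  have [w [_ pw]] := cof_llp_afib cof_point (conj fib_p weq_p) sq0.
  pose t (b : two_points_graph) : c := if b then gm_fun u tt else gm_fun w tt.
  have tE x y : edge x y -> edge (t x) (t y).
    by move/eqP=> <-; rewrite /t; case: x; apply: graph_map_edge.
  have sq1 : graph_comp p (mk_graph_map tE) = graph_comp v i.
    apply/graph_comp_eqP => b; rewrite mk_graph_mapE; case: b; rewrite /t.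
      by move/graph_comp_eqP: sq => ->; rewrite mk_graph_mapE.
    by rewrite (graph_comp_apply pw) !graph_compE mk_graph_mapE.
  have [h [hi hv]] := cof_llp_afib cof_i (conj fib_p weq_p) sq1.
  exists h; split=> //; apply: graph_map_eq => -[].
  rewrite graph_compE mk_graph_mapE.
  by rewrite (graph_comp_apply hi) mk_graph_mapE.
have ctrK : contractible K by apply/contractible_to_point/weqP/weq_q.
have [E [j [p [[_ weq_j] fib_p _]]]] := factor_acof_fib M
  (point_map (cycle7_loop ord0) : @hom graph_category _ _).
have ctrE : contractible E by apply/contractible_of_point/weqP/weq_j.
apply: (@contractible_not_llp_cycle7 K E k0 k1 k00 p (gm_fun j tt)) => //.
  exact: graph_map_edge.
exact: (acof_llp_fib (conj cof_k weq_k) fib_p).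
Qed.
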